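(* Let $a,b$ be real numbers with $0<b<a$ and $a>1$. Then the function $M_{a,b}:(0,\infty)\to\mathbb R$, $$M_{a,b}(x)=x^{a-b}\frac{\Gamma(x+b)}{\Gamma(x+a)},$$ belongs to $\mathcal T_{a-b,-3}$.
   Context: A function $f:(0,\infty)\to\mathbb R$ is completely monotonic if it is infinitely often differentiable and $(-1)^n f^{(n)}(x)\ge 0$ for all $n=0,1,2,\ldots$ and all $x>0$. A function $\varphi:(0,\infty)\to\mathbb R$ is completely monotonic of order $\alpha\in\mathbb R$ if $t\mapsto t^{\alpha}\varphi(t)$ is completely monotonic. For $\lambda>0$ the incomplete Gamma function is $\gamma(\lambda,x)=\int_0^x t^{\lambda-1}e^{-t}\,dt$. For $\lambda>0$ and $\alpha<\lambda+1$, the class $\mathcal T_{\lambda,\alpha}$ of higher order Thorin-Bernstein functions consists of all functions $f$ on $(0,\infty)$ that can be written as $$f(x)=A x^{\lambda}+B+\int_0^\infty \gamma(\lambda,xt)\varphi(t)\,dt,\quad x>0,$$ where $A,B\ge 0$ and $\varphi$ is completely monotonic of order $\alpha$ such that the integral converges for all $x>0$. *)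

(* Defs.v *)
From HB Require Import structures.
From mathcomp Require Import all_boot all_order all_algebra.
From mathcomp Require Import all_classical all_reals all_analysis.
Set Implicit Arguments.
Unset Strict Implicit.
Unset Printing Implicit Defensive.
Import Order.TTheory GRing.Theory Num.Theory.
Import numFieldNormedType.Exports.
Local Open Scope classical_set_scope.
Local Open Scope ring_scope.

(* Functions on (0, +oo) are represented by total functions R -> R of which   *)
(* only the restriction to positive arguments matters: every definition below *)
(* depends only on their values on this open set.                             *)

Definition completely_monotonic (R : realType) (f : R -> R) : Prop :=
  forall (n : nat) (x : R), 0 < x ->
    derivable (derive1n n f) x 1 /\ 0 <= (-1) ^+ n * derive1n n f x.

Definition completely_monotonic_of_order (R : realType) (alpha : R)
    (phi : R -> R) : Prop :=
  completely_monotonic (fun t : R => t `^ alpha * phi t).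

(* The integrand is integrable when 0 < s; for other s the value is junk.     *)
Definition Gamma (R : realType) (s : R) : R :=
  \int[lebesgue_measure]_(t in `]0, +oo[) (t `^ (s - 1) * expR (- t)).

(* The integrand is integrable when 0 < lambda.                               *)
Definition incomplete_gamma (R : realType) (lambda x : R) : R :=
  \int[lebesgue_measure]_(t in `]0, x[) (t `^ (lambda - 1) * expR (- t)).

(* The integrand defining f is nonnegative, so convergence of the integral is *)
(* the same as Lebesgue integrability. The first two conjuncts are the        *)
(* parameter range for which the class is defined.                            *)
Definition thorin_bernstein (R : realType) (lambda alpha : R)
    (f : R -> R) : Prop :=
  [/\ 0 < lambda, alpha < lambda + 1 &
   exists (A B : R) (phi : R -> R),
     [/\ 0 <= A, 0 <= B, completely_monotonic_of_order alpha phi,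
         forall x : R, 0 < x ->
           lebesgue_measure.-integrable `]0, +oo[
             (fun t : R => (incomplete_gamma lambda (x * t) * phi t)%:E) &
         forall x : R, 0 < x ->
           f x = A * x `^ lambda + B +
             \int[lebesgue_measure]_(t in `]0, +oo[)
               (incomplete_gamma lambda (x * t) * phi t)]].

Definition gamma_ratio (R : realType) (a b x : R) : R :=
  x `^ (a - b) * (Gamma (x + b) / Gamma (x + a)).

(* Main.v *)
Require Import Defs.
From mathcomp Require Import all_boot all_order all_algebra.
From mathcomp Require Import all_classical all_reals all_analysis.
From mathcomp Require Import measurable_realfun.
From mathcomp Require Import ring lra.
Import Order.TTheory GRing.Theory Num.Theory.
Import numFieldNormedType.Exports.
Local Open Scope classical_set_scope.
Local Open Scope ring_scope.

(**
  Put l = a - b, q(t) = (1 - e^(-t))/t and G(t) = e^(-bt) q(t)^(l-1). The Beta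
  integral, written in the variable s with u = e^(-s), is
    Gamma(l) Gamma(x+b) / Gamma(x+a) = int_0^oo e^(-(x+b)s) (1 - e^(-s))^(l-1) ds
                                     = int_0^oo s^(l-1) e^(-xs) G(s) ds
  ([Gamma_mul_beta]). The function G vanishes at infinity, so G(s) is the
  integral of -G' over (s, oo). Multiplying by x^l and exchanging the two
  integrals turns the right-hand side into
    int_0^oo gamma(l, xt) (-G'(t)) dt
  ([integral_incomplete_gamma_density] and [integral_gamma_tail]). Hence the
  ratio has the required form with A = B = 0 and phi = -G'/Gamma(l).

  It remains to see that t^(-3) (-G'(t)) is completely monotonic
  ([alternating_density]). With r = -q',
    -G' = e^(-bt) q^(l-2) (b q + (l-1) r),
  and the functions q, r and q - r are the integrals over u in [0, 1] of
  e^(-tu), u e^(-tu) and (1-u) e^(-tu), all completely monotonic. So is the last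
  factor: this is clear if l >= 1, and otherwise it is
  (a-1) q + (1-l) (q - r), where a > 1. Finally l - 2 > -2 and t^(-2) q^nu is
  completely monotonic for every nu >= -2 ([alternating_powR_moment0]), so that
  already t^(-2) (-G'(t)) is completely monotonic.

  All facts on complete monotonicity are obtained by explicit differentiation,
  without integral representations.
*)

(** * Complete monotonicity *)

Section CompleteMonotonicity.
Local Set Implicit Arguments.
Local Unset Strict Implicit.
Context {R : realType}.
Implicit Types (f g h : R -> R) (n : nat).

Lemma is_derive_pos_congr f g (x d : R) : 0 < x ->
  (forall t, 0 < t -> f t = g t) -> is_derive x 1 f d -> is_derive x 1 g d.
Proof.
move=> x0 fg; apply: near_eq_is_derive.
by near=> t; apply: fg; near: t; exact: lt_nbhsr.
Unshelve. all: by end_near. Qed.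

(** Only the first [n] derivatives are constrained, and they are given by
    witnesses rather than by iterated derivatives. This makes the closure under
    products a plain induction, since (fg)' is again a sum of two products, with
    no need for the binomial Leibniz formula. *)
Fixpoint alternating n f : Prop :=
  (forall x : R, 0 < x -> 0 <= f x) /\
  if n is m.+1 then
    exists g, (forall x : R, 0 < x -> is_derive x 1 f (- g x)) /\ alternating m g
  else True.

Lemma alternating_ge0 n f (x : R) : alternating n f -> 0 < x -> 0 <= f x.
Proof. by case: n => [|n] [+ _]; apply. Qed.

Lemma alternatingW n f : alternating n.+1 f -> alternating n f.
Proof.
elim: n f => [|n ih] f [f0 [g [fg ag]]]; split => //.
by exists g; split => //; exact: ih.
Qed.

Lemma alternating_congr n f g :
  (forall x, 0 < x -> f x = g x) -> alternating n f -> alternating n g.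
Proof.
move=> fg; case: n => [|n] [f0 af]; split => //.
- by move=> x x0; rewrite -fg// f0.
- by move=> x x0; rewrite -fg// f0.
case: af => h [fh ah]; exists h; split => // x x0.
exact: is_derive_pos_congr (fh x x0).
Qed.

Lemma alternatingD n f g : alternating n f -> alternating n g ->
  alternating n (fun x => f x + g x).
Proof.
elim: n f g => [|n ih] f g [f0 af] [g0 ag]; split => //.
- by move=> x x0; rewrite addr_ge0 ?f0 ?g0.
- by move=> x x0; rewrite addr_ge0 ?f0 ?g0.
case: af ag => [f' [ff' af]] [g' [gg' ag]].
exists (fun x => f' x + g' x); split; last exact: ih.
move=> x x0; rewrite opprD.
exact: (is_deriveD (ff' x x0) (gg' x x0)).
Qed.

(** The opposite of (fg)' is f (-g') + (-f') g, whose factors are alternating to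
    one order less. *)
Lemma alternatingM n f g : alternating n f -> alternating n g ->
  alternating n (fun x => f x * g x).
Proof.
elim: n f g => [|n ih] f g af ag.
  by split => // x x0; rewrite mulr_ge0 ?(alternating_ge0 af) ?(alternating_ge0 ag).
have [fW gW] := (alternatingW af, alternatingW ag).
case: af ag => [f0 [f' [ff' af]]] [g0 [g' [gg' ag]]]; split.
  by move=> x x0; rewrite mulr_ge0 ?f0 ?g0.
exists (fun x => f x * g' x + f' x * g x); split.
  move=> x x0; apply: is_derive_eq (is_deriveM (ff' x x0) (gg' x x0)) _.
  rewrite /GRing.scale/=; ring.
by apply: alternatingD; exact: ih.
Qed.

Lemma alternating_cst n (c : R) : 0 <= c -> alternating n (fun=> c).
Proof.
elim: n c => [|n ih] c c0; split => //; exists (fun=> 0); split; last exact: ih.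
by move=> x _; rewrite oppr0; exact: is_derive_cst.
Qed.

Lemma alternatingZ n (c : R) f : 0 <= c -> alternating n f ->
  alternating n (fun x => c * f x).
Proof. by move=> c0; move=> af; exact: alternatingM (alternating_cst n c0) af. Qed.

Lemma alternating_seq (F : nat -> R -> R) n k :
  (forall k x, 0 < x -> 0 <= F k x) ->
  (forall k (x : R), 0 < x -> is_derive x 1 (F k) (- F k.+1 x)) ->
  alternating n (F k).
Proof.
move=> F0 FF; elim: n k => [|n ih] k; split => //.
- exact: F0.
- exact: F0.
by exists (F k.+1); split => //; exact: FF.
Qed.

Lemma derive1n_alternating n m f : alternating (n + m) f ->
  exists2 g, alternating m g &
    forall x : R, 0 < x -> derive1n n f x = (-1) ^+ n * g x.
Proof.
elim: n m => [|n ih] m af; first by exists f => // x x0; rewrite expr0 mul1r.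
rewrite addSnnS in af; have [g [_ [g' [gg' ag']]] fg] := ih _ af.
exists g' => // x x0; rewrite derive1nS derive1E.
suff D : is_derive x 1 (derive1n n f) ((-1) ^+ n.+1 * g' x).
  by rewrite (@derive_val _ _ _ _ _ _ _ D).
apply: (@is_derive_pos_congr (fun t => (-1) ^+ n * g t)) => //.
  by move=> t t0; rewrite fg.
apply: is_derive_eq (is_deriveZ ((-1) ^+ n) (gg' x x0)) _.
by rewrite /GRing.scale/= exprS mulrN mulN1r mulNr.
Qed.

Lemma alternating_completely_monotonic f :
  (forall n, alternating n f) -> completely_monotonic f.
Proof.
move=> af n x x0.
have [|g ag fg] := @derive1n_alternating n 1 f; first exact: af.
case: ag => g0 [g' [gg' _]]; split; last first.
  by rewrite fg// mulrA -exprD addnn -mul2n exprM sqrrN expr1n expr1n mul1r g0.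
have : is_derive x 1 (derive1n n f) ((-1) ^+ n *: - g' x); last by case.
apply: (@is_derive_pos_congr (fun t => (-1) ^+ n * g t)) => //.
  by move=> t t0; rewrite fg.
exact: (is_deriveZ ((-1) ^+ n) (gg' x x0)).
Qed.

Lemma alternating_powRN n (p : R) : 0 <= p ->
  alternating n (fun x : R => x `^ (- p)).
Proof.
elim: n p => [|n ih] p p0; split => //.
- by move=> x x0; exact: powR_ge0.
- by move=> x x0; exact: powR_ge0.
exists (fun x => p * x `^ (- (p + 1))); split.
  move=> x x0; apply: is_derive_eq (is_derive1_powR (- p) x0) _.
  by rewrite opprD mulNr.
by apply: alternatingZ => //; apply: ih; rewrite addr_ge0.
Qed.

Lemma is_derive_expRN (b x : R) :
  is_derive x 1 (fun t => expR (- (b * t))) (- (b * expR (- (b * x)))).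
Proof.
apply: is_derive_eq.
rewrite /GRing.scale/=; ring.
Qed.

Lemma alternating_expRN n (b : R) : 0 <= b ->
  alternating n (fun x : R => expR (- (b * x))).
Proof.
move=> b0; elim: n => [|n ih]; split => //.
exists (fun x => b * expR (- (b * x))); split; last exact: alternatingZ.
by move=> x _; exact: is_derive_expRN.
Qed.

Lemma subr_expRN_gt0 (x : R) : 0 < x -> 0 < 1 - expR (- x).
Proof. by move=> x0; rewrite subr_gt0 expR_lt1 oppr_lt0. Qed.

(** Each differentiation yields a factor [expR (- x)], alternating to all orders,
    and a power whose exponent has decreased by 1: the induction has to run over
    all [k] at once. *)
Lemma alternating_powRN_expRN n (k : R) : 0 <= k ->
  alternating n (fun x : R => (1 - expR (- x)) `^ (- k)).
Proof.
elim: n k => [|n ih] k k0; split => //.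
- by move=> x x0; exact: powR_ge0.
- by move=> x x0; exact: powR_ge0.
exists (fun x => k * (expR (- (1 * x)) * (1 - expR (- x)) `^ (- (k + 1)))).
split.
  move=> x x0.
  have h : is_derive x 1 (fun t : R => 1 - expR (- t)) (expR (- x)).
    apply: is_derive_eq; rewrite /GRing.scale/=; ring.
  have := is_derive1_powR (- k) (subr_expRN_gt0 x0).
  move=> hp; have := @is_derive1_comp _ (fun y => y `^ (- k))
    (fun t => 1 - expR (- t)) _ _ _ hp h.
  move=> H; apply: is_derive_eq H _.
  rewrite mul1r opprD; ring.
apply: alternatingZ => //; apply: alternatingM.
  exact: alternating_expRN.
by apply: ih; rewrite addr_ge0.
Qed.

End CompleteMonotonicity.

(** * Moments of the exponential over the unit interval *)

Section Moments.
Local Set Implicit Arguments.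
Local Unset Strict Implicit.
Context {R : realType}.
Implicit Types (t : R) (k n : nat).

Lemma ge0_of_derive (f f' : R -> R) : f 0 = 0 ->
  (forall x : R, is_derive x 1 f (f' x)) ->
  (forall x : R, 0 < x -> 0 <= f' x) -> forall x : R, 0 < x -> 0 <= f x.
Proof.
move=> f0 ff' f'0 x x0.
have [|c] := @MVT _ f f' 0 x x0 (fun c _ => ff' c).
  apply: continuous_subspaceT => z.
  apply/differentiable_continuous/derivable1_diffP.
  by have [] := ff' z.
rewrite in_itv/= => /andP[c0 _]; rewrite f0 !subr0 => ->.
by rewrite mulr_ge0 ?f'0 // ltW.
Qed.

(** The incomplete Gamma function at the integer parameter [k.+1], by the
    recurrence that integration by parts gives; no integral is needed to define
    it or to bound it. *)
Fixpoint trunc_gamma k t : R :=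
  if k is j.+1 then k%:R * trunc_gamma j t - t ^+ k * expR (- t)
  else 1 - expR (- t).

Lemma trunc_gammaS k t : trunc_gamma k.+1 t =
  k.+1%:R * trunc_gamma k t - t ^+ k.+1 * expR (- t).
Proof. by []. Qed.

Lemma trunc_gamma0 k : trunc_gamma k 0 = 0.
Proof.
elim: k => [|k ih]; first by rewrite /= oppr0 expR0 subrr.
by rewrite trunc_gammaS ih mulr0 exprS !mul0r subrr.
Qed.

Lemma is_derive_expRNx t : is_derive t 1 (fun x : R => expR (- x)) (- expR (- t)).
Proof. by apply: is_derive_eq; rewrite /GRing.scale/= mulrN1. Qed.

Lemma is_derive_exprS k t :
  is_derive t 1 (fun x => x ^+ k.+1) (k.+1%:R * t ^+ k).
Proof.
elim: k => [|k ih]; first by rewrite mulr1; exact: is_derive_id.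
apply: is_derive_eq (is_deriveM (is_derive_id t 1) ih) _.
by rewrite /GRing.scale/= mulr1 mulrCA -exprS -[k.+2%:R]natr1 mulrDl mul1r.
Qed.

Lemma is_derive_exprS_expRN k t :
  is_derive t 1 (fun x => x ^+ k.+1 * expR (- x))
    (k.+1%:R * (t ^+ k * expR (- t)) - t ^+ k.+1 * expR (- t)).
Proof.
apply: is_derive_eq (is_deriveM (is_derive_exprS k t) (is_derive_expRNx t)) _.
rewrite /GRing.scale/=; ring.
Qed.

Lemma is_derive_trunc_gamma k t :
  is_derive t 1 (trunc_gamma k) (t ^+ k * expR (- t)).
Proof.
elim: k => [|k ih].
  rewrite expr0 mul1r.
  have H := is_deriveB (is_derive_cst (1 : R) t 1) (is_derive_expRNx t).
  by apply: is_derive_eq H _; rewrite sub0r opprK.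
have H := is_deriveB (is_deriveZ k.+1%:R ih) (is_derive_exprS_expRN k t).
apply: is_derive_eq H _.
by rewrite /GRing.scale/= opprB addrCA subrr addr0.
Qed.

Lemma trunc_gamma_ge0 k t : 0 < t -> 0 <= trunc_gamma k t.
Proof.
apply: ge0_of_derive (is_derive_trunc_gamma k) _ _; first exact: trunc_gamma0.
by move=> x x0; rewrite mulr_ge0 ?expR_ge0// exprn_ge0// ltW.
Qed.

(** The difference of the two sides vanishes at 0 and has derivative
    [trunc_gamma k t]. It is what makes the moments decrease with [k], as the
    integral formula of [moment] suggests. *)
Lemma trunc_gammaS_le k t : 0 < t -> trunc_gamma k.+1 t <= t * trunc_gamma k t.
Proof.
move=> t0; rewrite -subr_ge0.
apply: (@ge0_of_derive (fun x => x * trunc_gamma k x - trunc_gamma k.+1 x)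
  (trunc_gamma k)) t0.
- by rewrite !trunc_gamma0 mulr0 subrr.
- move=> x.
  have H := is_deriveB (is_deriveM (is_derive_id x 1) (is_derive_trunc_gamma k x))
    (is_derive_trunc_gamma k.+1 x).
  apply: is_derive_eq H _.
  rewrite /GRing.scale/= exprS; ring.
- exact: trunc_gamma_ge0.
Qed.

(** This is the integral of u^k e^(-tu) over u in [0, 1], so that [moment 0] is
    (1 - e^(-t))/t and differentiation in t sends [moment k] to the opposite of
    [moment k.+1]. *)
Definition moment k t : R := trunc_gamma k t / t ^+ k.+1.

Lemma is_derive_moment k t : 0 < t ->
  is_derive t 1 (moment k) (- moment k.+1 t).
Proof.
move=> t0; have tn0 : t != 0 by rewrite gt_eqF.
have tk0 : t ^+ k.+1 != 0 by rewrite expf_neq0.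
have H := is_deriveM (is_derive_trunc_gamma k t)
  (@is_deriveV _ (fun x => x ^+ k.+1) _ _ _ tk0 (is_derive_exprS k t)).
apply: is_derive_eq H _.
rewrite /moment trunc_gammaS /GRing.scale/=.
rewrite !exprS; field.
by rewrite tn0 expf_neq0.
Qed.

Lemma moment_ge0 k t : 0 < t -> 0 <= moment k t.
Proof. by move=> t0; rewrite divr_ge0 ?trunc_gamma_ge0// exprn_ge0// ltW. Qed.

Lemma moment_noninc k t : 0 < t -> moment k.+1 t <= moment k t.
Proof.
move=> t0; have -> : moment k t = (t * trunc_gamma k t) / t ^+ k.+2.
  by rewrite [in RHS]exprS -mulf_div divff ?mul1r// gt_eqF.
by rewrite ler_wpM2r ?trunc_gammaS_le// invr_ge0 exprn_ge0// ltW.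
Qed.

Lemma moment0_gt0 t : 0 < t -> 0 < moment 0 t.
Proof. by move=> t0; rewrite divr_gt0// subr_expRN_gt0. Qed.

Lemma alternating_moment n k : alternating n (@moment k).
Proof.
by apply: alternating_seq => *; [exact: moment_ge0|exact: is_derive_moment].
Qed.

Lemma alternating_momentB n :
  alternating n (fun t => moment 0 t - moment 1 t).
Proof.
apply: (@alternating_seq _ (fun k t => moment k t - moment k.+1 t)) => k t t0.
  by rewrite subr_ge0 moment_noninc.
apply: is_derive_eq (is_deriveB (is_derive_moment k t0)
  (is_derive_moment k.+1 t0)) _.
by rewrite opprB opprK addrC.
Qed.

Lemma powRD_gt0 (x r s : R) : 0 < x -> x `^ (r + s) = x `^ r * x `^ s.
Proof. by move=> x0; rewrite powRD// (gt_eqF x0) implybT. Qed.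

Lemma moment0E t : moment 0 t = (1 - expR (- t)) / t.
Proof. by []. Qed.

Lemma powR_moment0 (nu t : R) : 0 < t ->
  moment 0 t `^ nu = (1 - expR (- t)) `^ nu * t `^ (- nu).
Proof.
move=> t0; rewrite moment0E powRM ?invr_ge0 1?ltW ?subr_expRN_gt0//.
by rewrite -powR_inv1 ?ltW// -powRrM mulN1r.
Qed.

(** Powers of [moment 0] alone need not be completely monotonic. For [nu <= 0] the
    two exponents of t^(-2-nu) (1 - e^(-t))^nu are nonpositive and both
    factors are completely monotonic; one then goes up from [nu] to [nu + 1]
    through a multiplication by the completely monotonic [moment 0]. *)
Lemma alternating_powR_moment0 n (nu : R) : - 2 <= nu ->
  alternating n (fun t => t `^ (- 2) * moment 0 t `^ nu).
Proof.
move=> nu2; have [m] : exists m : nat, nu <= m%:R.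
  by exists (Num.truncn nu).+1; exact/ltW/truncnS_gt.
elim: m nu nu2 => [|m ih] nu nu2 num.
  (* here [nu <= 0], which is the base case of the induction on [m] *)
  apply: (@alternating_congr _ _ (fun t =>
      t `^ (- (2 + nu)) * (1 - expR (- t)) `^ (- - nu))).
    move=> t t0; by rewrite powR_moment0// opprK mulrCA mulrC opprD (powRD_gt0 _ _ t0).
  apply: alternatingM; first by apply: alternating_powRN; lra.
  by apply: alternating_powRN_expRN; lra.
have m0 : 0 <= m%:R :> R by [].
have [nu1|nu1] := leP nu (- 1); first by apply: ih => //; lra.
apply: (@alternating_congr _ _ (fun t =>
    t `^ (- 2) * moment 0 t `^ (nu - 1) * moment 0 t)).
  move=> t t0; rewrite -mulrA; congr (_ * _).
  have q0 := moment0_gt0 t0.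
  rewrite -[in RHS](subrK 1 nu) [in RHS]powRD_gt0//.
  by rewrite powRr1// ltW.
apply: alternatingM (alternating_moment n 0); apply: ih; first lra.
by rewrite lerBlDr natr1.
Qed.

End Moments.

(** * The density *)

Section Kernel.
Local Set Implicit Arguments.
Local Unset Strict Implicit.
Context {R : realType}.
Variables (b nu : R).
Implicit Types (t : R) (n : nat).

(** In the intended use [nu] is [a - b - 1]. Then t^nu [tail t] is the function
    e^(-bt) (1 - e^(-t))^nu of which the Beta integral is the Laplace
    transform, and [density] is the opposite of the derivative of [tail]. *)
Definition tail t : R := expR (- (b * t)) * moment 0 t `^ nu.

Definition density t : R :=
  expR (- (b * t)) *
  (moment 0 t `^ (nu - 1) * (b * moment 0 t + nu * moment 1 t)).

Lemma is_derive_tail t : 0 < t -> is_derive t 1 tail (- density t).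
Proof.
move=> t0; have q0 := moment0_gt0 t0.
have Hq := @is_derive1_comp _ (fun y => y `^ nu) (moment 0) _ _ _
  (is_derive1_powR nu q0) (is_derive_moment 0 t0).
apply: is_derive_eq (is_deriveM (is_derive_expRN b t) Hq) _.
rewrite /GRing.scale/= /density.
have -> : moment 0 t `^ nu = moment 0 t `^ (nu - 1) * moment 0 t.
  rewrite -[in LHS](subrK 1 nu) [in LHS]powRD_gt0//.
  by rewrite powRr1// ltW.
ring.
Qed.

(** The factor [b * moment 0 t + nu * moment 1 t] has a negative coefficient when
    [nu < 0]; it is then rewritten on the completely monotonic functions
    [moment 0] and [moment 0 - moment 1], with coefficients [b + nu] and [- nu].
    This is where [0 < b + nu], that is [1 < a], matters. *)
Lemma alternating_density n : 0 < b -> -1 < nu -> 0 < b + nu ->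
  alternating n (fun t => t `^ (- 3) * density t).
Proof.
move=> b0 nu1 bnu.
apply: (@alternating_congr _ _ (fun t =>
    expR (- (b * t)) * t `^ (- 1) * (t `^ (- 2) * moment 0 t `^ (nu - 1)) *
    (b * moment 0 t + nu * moment 1 t))).
  move=> t t0; rewrite /density.
  have -> : t `^ (- 3) = t `^ (- 1) * t `^ (- 2).
    by rewrite -powRD_gt0//; congr (_ `^ _); lra.
  ring.
apply: alternatingM.
  apply: alternatingM.
    apply: alternatingM; first by apply: alternating_expRN; exact: ltW.
    exact: alternating_powRN.
  by apply: alternating_powR_moment0; lra.
have [nu0|nu0] := leP 0 nu.
  by apply: alternatingD; apply: alternatingZ; rewrite ?(ltW b0)//;
    exact: alternating_moment.
apply: (@alternating_congr _ _ (fun t =>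
    (b + nu) * moment 0 t + (- nu) * (moment 0 t - moment 1 t))).
  by move=> t _; ring.
apply: alternatingD; apply: alternatingZ.
- exact: ltW.
- exact: alternating_moment.
- lra.
- exact: alternating_momentB.
Qed.

Lemma continuous_density t : 0 < t -> {for t, continuous density}.
Proof.
move=> t0; have q0 := moment0_gt0 t0.
have Hq := @is_derive1_comp _ (fun y => y `^ (nu - 1)) (moment 0) _ _ _
  (is_derive1_powR (nu - 1) q0) (is_derive_moment 0 t0).
have [D _] := is_deriveM (is_derive_expRN b t) (is_deriveM Hq
  (is_deriveD (is_deriveZ b (is_derive_moment 0 t0))
              (is_deriveZ nu (is_derive_moment 1 t0)))).
exact/differentiable_continuous/derivable1_diffP.
Qed.

Lemma moment0_le1 t : 0 < t -> moment 0 t <= 1.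
Proof.
move=> t0; rewrite moment0E ler_pdivrMr// mul1r lerBlDr.
have := expR_ge1Dx (- t); lra.
Qed.

(** This bounds the negative powers of [moment 0] occurring in [tail]. *)
Lemma moment0_inv_le t : 0 < t -> (moment 0 t)^-1 <= 1 + t.
Proof.
move=> t0; rewrite -[leRHS]invrK lef_pV2 ?posrE ?moment0_gt0 ?invr_gt0 ?addr_gt0//.
rewrite moment0E expRN ler_pdivlMr//.
have : (expR t)^-1 <= (1 + t)^-1.
  by rewrite lef_pV2 ?posrE ?expR_gt0 ?addr_gt0// expR_ge1Dx.
suff -> : (1 + t)^-1 * t = 1 - (1 + t)^-1 by lra.
by field; rewrite gt_eqF ?addr_gt0.
Qed.

Lemma tail_ge0 t : 0 <= tail t.
Proof. by rewrite mulr_ge0 ?expR_ge0 ?powR_ge0. Qed.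

Lemma tail_le t : -1 < nu -> 0 < t -> tail t <= (1 + t) * expR (- (b * t)).
Proof.
move=> nu1 t0; rewrite /tail mulrC ler_wpM2r ?expR_ge0//.
have q0 := moment0_gt0 t0; have q1 := moment0_le1 t0.
have [nu0|nu0] := leP 0 nu.
  rewrite (@le_trans _ _ 1)//; last by rewrite lerDl ltW.
  rewrite -(powRr0 (moment 0 t)).
  by apply: ger_powR => //; rewrite q0.
apply: le_trans (moment0_inv_le t0).
rewrite -powR_inv1; last exact: ltW.
by apply: ger_powR; [rewrite q0|rewrite ltW].
Qed.

Lemma tail_cvg0 : 0 < b -> -1 < nu -> tail x @[x --> +oo] --> 0.
Proof.
move=> b0 nu1; have b20 : 0 < b / 2 by rewrite divr_gt0.
have h : (1 + 2 / b) * expR (- (b / 2 * x)) @[x --> +oo] --> (0 : R).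
  rewrite -(mulr0 (1 + 2 / b)); apply: cvgMr.
  apply: (@cvg_comp _ _ _ (fun x : R => b / 2 * x) (fun x => expR (- x)) _ +oo).
    exact: gt0_cvgMry.
  exact: cvgr_expR.
apply: (squeeze_cvgr _ (cvg_cst 0) h).
near=> x; rewrite tail_ge0/=; have x0 : 0 < x by near: x; exact: nbhs_pinfty_gt.
apply: le_trans (tail_le nu1 x0) _.
have -> : - (b * x) = - (b / 2 * x) - b / 2 * x by field.
rewrite expRD mulrA ler_wpM2r ?expR_ge0//.
rewrite expRN ler_pdivrMr ?expR_gt0//.
have := expR_ge1Dx (b / 2 * x).
have : (1 + 2 / b) * (1 + b / 2 * x) = 1 + x + 2 / b + b / 2 * x.
  by field; rewrite gt_eqF.
have : 0 < 2 / b by rewrite divr_gt0.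
have : 0 < b / 2 * x by rewrite mulr_gt0.
move: (2 / b) (b / 2 * x) => c d d0 c0 cd dE.
suff : (1 + c) * (1 + d) <= (1 + c) * expR d by lra.
by rewrite ler_wpM2l// ltW// addr_gt0.
Unshelve. all: by end_near. Qed.

End Kernel.

(** * Integrals over the positive half-line *)

Section PositiveHalfLine.
Local Set Implicit Arguments.
Local Unset Strict Implicit.
Context {R : realType}.
Notation mu := (@lebesgue_measure R).
Notation pos := (`]0%R, +oo[%classic : set R).
Implicit Types (f g F : R -> R).

Lemma posE (x : R) : pos x <-> 0 < x.
Proof. by rewrite /= in_itv/= andbT. Qed.

Lemma is_derive_continuous f (x d : R) : is_derive x 1 f d -> {for x, continuous f}.
Proof.
by move=> [fx _]; apply/differentiable_continuous/derivable1_diffP.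
Qed.

Lemma continuous_pos_measurable f :
  (forall x : R, 0 < x -> {for x, continuous f}) -> measurable_fun pos f.
Proof.
move=> cf; apply: open_continuous_measurable_fun; first exact: interval_open.
by move=> x; rewrite inE => /posE; exact: cf.
Qed.

Lemma continuous_pos_within f (a b : R) : 0 < a ->
  (forall x : R, 0 < x -> {for x, continuous f}) ->
  {within `[a, b], continuous f}.
Proof.
move=> a0 cf; apply: continuous_in_subspaceT => x.
rewrite inE/= in_itv/= => /andP[ax _]; apply: cf.
exact: lt_le_trans ax.
Qed.

Lemma integral_pos_exhaustion f (S : nat -> set R) :
  (forall n m, (n <= m)%N -> S n `<=` S m) -> (forall n, measurable (S n)) ->
  (forall n, S n `<=` pos) -> (forall x : R, 0 < x -> exists n, S n x) ->
  measurable_fun pos f -> (forall x : R, 0 < x -> 0 <= f x) ->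
  (\int[mu]_(x in S n) (f x)%:E @[n --> \oo] --> \int[mu]_(x in pos) (f x)%:E)%E.
Proof.
move=> ndS mS Spos Sx mf f0.
have -> : pos = \bigcup_n S n.
  apply/seteqP; split=> [x /posE /Sx[n Snx]|x [n _] /Spos//].
  by exists n.
apply: ge0_nondecreasing_set_cvg_integral => //.
- by move=> n m nm; rewrite subsetEset; exact: ndS.
- move=> n; apply/measurable_EFinP; apply: measurable_funS mf => //.
- by move=> n x /Spos/posE/f0; rewrite lee_fin.
Qed.

(** The segments exhaust the half-line because [F] is an increasing bijection of
    it; with [F := id] they are the segments from 1/(n+1) to n+1. *)
Lemma integral_pos_segments f (F : R -> R) :
  (forall x y : R, 0 < x -> x <= y -> F x <= F y) ->
  (forall x : R, 0 < x -> 0 < F x) -> (forall y : R, 0 < y -> exists2 x : R, 0 < x & F x = y) ->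
  measurable_fun pos f -> (forall x : R, 0 < x -> 0 <= f x) ->
  (\int[mu]_(x in `[(F n.+1%:R^-1)%R, (F n.+1%:R)%R]) (f x)%:E @[n --> \oo] -->
   \int[mu]_(x in pos) (f x)%:E)%E.
Proof.
move=> ndF F0 surjF mf f0.
apply: (@integral_pos_exhaustion f (fun n => `[F n.+1%:R^-1, F n.+1%:R]%classic)) => //.
- move=> n m nm x /=; rewrite !in_itv/= => /andP[Fx xF]; apply/andP; split.
    apply: le_trans Fx; apply: ndF; first by rewrite invr_gt0.
    by rewrite lef_pV2 ?posrE// ler_nat.
  by apply: le_trans xF _; apply: ndF => //; rewrite ler_nat.
- move=> n x /=; rewrite !in_itv/= => /andP[Fx _]; rewrite andbT.
  by apply: lt_le_trans Fx; apply: F0; rewrite invr_gt0.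
- move=> y /surjF[x x0 <-].
  exists (maxn (Num.truncn x) (Num.truncn x^-1)).
  rewrite /= in_itv/=; apply/andP; split; apply: ndF => //.
    rewrite -[leRHS]invrK lef_pV2 ?posrE ?invr_gt0//.
    apply: ltW; apply: lt_le_trans (truncnS_gt _) _.
    by rewrite ler_nat ltnS leq_maxr.
  apply: ltW; apply: lt_le_trans (truncnS_gt _) _.
  by rewrite ler_nat ltnS leq_maxl.
Qed.

(** Neither [g] nor [f] is assumed to have a limit at 0 or at infinity, which
    allows singular integrands such as t^(l-1) and exponential substitutions.
    Hence the passage through compact segments. *)
Lemma integral_pos_substitution (F f g : R -> R) :
  (forall x : R, 0 < x -> is_derive x 1 F (f x)) ->
  (forall x : R, 0 < x -> {for x, continuous f}) ->
  (forall x : R, 0 < x -> 0 <= f x) ->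
  (forall x y : R, 0 < x -> x < y -> F x < F y) ->
  (forall x : R, 0 < x -> 0 < F x) -> (forall y : R, 0 < y -> exists2 x : R, 0 < x & F x = y) ->
  (forall x : R, 0 < x -> {for x, continuous g}) -> (forall x : R, 0 < x -> 0 <= g x) ->
  (\int[mu]_(x in pos) (g x)%:E = \int[mu]_(x in pos) (g (F x) * f x)%:E)%E.
Proof.
move=> Ff cf f0 incF F0 surjF cg g0.
have cF (x : R) : 0 < x -> {for x, continuous F}.
  by move=> /Ff; exact: is_derive_continuous.
have ndF (x y : R) : 0 < x -> x <= y -> F x <= F y.
  by move=> x0; rewrite le_eqVlt => /predU1P[->//|/incF-/(_ x0)/ltW].
have cgF (x : R) : 0 < x -> {for x, continuous (fun z => g (F z) * f z)}.
  move=> x0; apply: cvgM; last exact: cf.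
  by apply: continuous_comp; [exact: cF|apply: cg; exact: F0].
have Fe : {in `]0, +oo[, (derive1 F) =1 f}.
  move=> x; rewrite in_itv/= andbT => /Ff Fx.
  by rewrite derive1E (@derive_val _ _ _ _ _ _ _ Fx).
have cF' (x : R) : 0 < x -> {for x, continuous (derive1 F)}.
  move=> x0; have /(cvg_trans _) := cf x x0; rewrite /prop_for/continuous_at Fe ?in_itv/= ?andbT//.
  apply; apply: near_eq_cvg; near=> y; rewrite Fe// in_itv/= andbT.
  near: y; exact: lt_nbhsr.
have L1 := integral_pos_segments ndF F0 surjF (continuous_pos_measurable cg) g0.
have L2 : (\int[mu]_(x in `[(n.+1%:R^-1)%R, n.+1%:R%R]) (g (F x) * f x)%:E @[n --> \oo] -->
   \int[mu]_(x in pos) (g (F x) * f x)%:E)%E.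
  apply: (@integral_pos_segments _ id) => //.
  - by move=> y y0; exists y.
  - exact: continuous_pos_measurable cgF.
  - by move=> x x0; rewrite mulr_ge0 ?f0// g0// F0.
rewrite -(cvg_lim _ L1)//; apply: cvg_lim => //.
apply: cvg_trans L2; apply: near_eq_cvg; near=> n.
have n0 : 0 < n.+1%:R^-1 :> R by rewrite invr_gt0.
have nn : n.+1%:R^-1 <= n.+1%:R :> R.
  by rewrite (@le_trans _ _ 1)// ?invf_le1// ler1n.
have ge0 (x : R) : x \in `[n.+1%:R^-1, n.+1%:R] -> 0 < x.
  by rewrite in_itv/= => /andP[/(lt_le_trans n0)].
rewrite integration_by_substitution_increasing//.
- apply: eq_integral => x; rewrite inE => /ge0 x0; congr EFin.
  by rewrite fctE/= Fe// in_itv/= andbT.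
- by move=> x y /ge0 x0 _; exact: incF.
- move=> x xn; apply: cF'; apply: ge0.
  exact: subset_itv_oo_cc xn.
- by apply: cvgP; apply: cvg_at_right_filter; exact: cF'.
- by apply: cvgP; apply: cvg_at_left_filter; apply: cF'.
- split.
  + by move=> x /subset_itv_oo_cc/ge0/Ff[].
  + by apply: cvg_at_right_filter; exact: cF.
  + by apply: cvg_at_left_filter; exact: cF.
- by apply: continuous_pos_within => //; exact: F0.
Unshelve. all: by end_near. Qed.

Lemma integral_pos_le_of_primitive (T f : R -> R) (M : R) :
  (forall x : R, 0 < x -> is_derive x 1 T (- f x)) ->
  (forall x : R, 0 < x -> {for x, continuous f}) ->
  (forall x : R, 0 < x -> 0 <= f x) ->
  (forall x : R, 0 < x -> 0 <= T x) -> (forall x : R, 0 < x -> T x <= M) ->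
  (\int[mu]_(x in pos) (f x)%:E <= M%:E)%E.
Proof.
move=> Tf cf f0 T0 TM.
have L : (\int[mu]_(x in `[(n.+1%:R^-1)%R, n.+1%:R%R]) (f x)%:E @[n --> \oo] -->
   \int[mu]_(x in pos) (f x)%:E)%E.
  apply: (@integral_pos_segments _ id) => //.
  - by move=> y y0; exists y.
  - exact: continuous_pos_measurable cf.
rewrite -(cvg_lim _ L)//; apply: lime_le; first exact: cvgP L.
near=> n.
have n0 : 0 < n.+1%:R^-1 :> R by rewrite invr_gt0.
have nn : n.+1%:R^-1 < n.+1%:R :> R.
  rewrite (@lt_le_trans _ _ 1)// ?ler1n// invf_lt1// ltr1n ltnS.
  by near: n; exact: nbhs_infty_gt.
have cT (x : R) : 0 < x -> {for x, continuous (fun z => - T z)}.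
  by move=> /Tf/is_derive_continuous cT; exact: cvgN.
have dT (x : R) : 0 < x -> is_derive x 1 (fun z => - T z) (f x).
  by move=> /Tf Tx; apply: is_derive_eq (is_deriveN Tx) _; rewrite opprK.
rewrite (@continuous_FTC2 _ f (fun z => - T z))//.
- rewrite -EFinB lee_fin opprK addrC.
  have := TM _ n0; have := T0 n.+1%:R (ltr0Sn _ _); lra.
- exact: continuous_pos_within.
- split.
  + move=> x; rewrite in_itv/= => /andP[nx _].
    by have [] := dT x (lt_trans n0 nx).
  + by apply: cvg_at_right_filter; exact: cT.
  + by apply: cvg_at_left_filter; exact: cT.
- move=> x; rewrite in_itv/= => /andP[nx _].
  by have Tx := dT x (lt_trans n0 nx); rewrite derive1E (@derive_val _ _ _ _ _ _ _ Tx).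
Unshelve. all: by end_near. Qed.

Lemma integral_tail (T f : R -> R) (s : R) : 0 < s ->
  (forall x : R, 0 < x -> is_derive x 1 T (- f x)) ->
  (forall x : R, 0 < x -> {for x, continuous f}) ->
  (forall x : R, 0 < x -> 0 <= f x) -> T x @[x --> +oo] --> 0 ->
  (\int[mu]_(x in `]s, +oo[) (f x)%:E = (T s)%:E)%E.
Proof.
move=> s0 Tf cf f0 Tl.
have cT (x : R) : 0 < x -> {for x, continuous (fun z => - T z)}.
  by move=> /Tf/is_derive_continuous cT; exact: cvgN.
have dT (x : R) : 0 < x -> is_derive x 1 (fun z => - T z) (f x).
  by move=> /Tf Tx; apply: is_derive_eq (is_deriveN Tx) _; rewrite opprK.
rewrite integral_itv_obnd_cbnd; last first.
  apply/measurable_EFinP; apply: measurable_funS (continuous_pos_measurable cf) => //.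
  by move=> x/=; rewrite !in_itv/= !andbT; exact: lt_trans.
rewrite (@ge0_continuous_FTC2y _ f (fun z => - T z) s 0).
- by rewrite -EFinB opprK add0r.
- by move=> x sx; apply: f0; exact: lt_le_trans sx.
- apply: continuous_in_subspaceT => x.
  rewrite inE/= in_itv/= andbT => sx; apply: cf.
  exact: lt_le_trans sx.
- by rewrite -oppr0; exact: cvgN.
- by move=> x sx; have [] := dT x (lt_trans s0 sx).
- by apply: cvg_at_right_filter; exact: cT.
- move=> x; rewrite in_itv/= andbT => sx.
  by have Tx := dT x (lt_trans s0 sx); rewrite derive1E (@derive_val _ _ _ _ _ _ _ Tx).
Qed.

(** The measurability of the inner integral comes with the exchange: it gives the
    measurability of t |-> [incomplete_gamma l (x * t)] below. *)
Lemma tonelli_pos (k : R -> R -> R) :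
  measurable_fun (pos `*` pos) (fun z => k z.1 z.2) ->
  (forall x y : R, 0 < x -> 0 < y -> 0 <= k x y) ->
  (\int[mu]_(x in pos) \int[mu]_(y in pos) (k x y)%:E =
   \int[mu]_(y in pos) \int[mu]_(x in pos) (k x y)%:E)%E /\
  measurable_fun pos (fun x => \int[mu]_(y in pos) (k x y)%:E)%E.
Proof.
move=> mk k0.
have mpp : measurable (pos `*` pos) by exact: measurableX.
pose K := (fun z : R * R => (k z.1 z.2)%:E) \_ (pos `*` pos).
have mK : measurable_fun setT K.
  by apply/(measurable_restrictT _ mpp)/measurable_EFinP.
have K0 z : (0 <= K z)%E.
  rewrite /K patchE; case: ifPn => // /set_mem[/posE z1 /posE z2].
  by rewrite lee_fin k0.
have E1 x : pos x -> (\int[mu]_y K (x, y) = \int[mu]_(y in pos) (k x y)%:E)%E.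
  move=> px; rewrite [RHS]integral_mkcond; apply: eq_integral => y _.
  rewrite /K !patchE; congr (if _ then _ else _).
  by apply/idP/idP; rewrite !inE/= => // -[].
have E1' x : ~ pos x -> (\int[mu]_y K (x, y) = 0)%E.
  move=> px; apply: integral0_eq => y _; rewrite /K patchE memNset//.
  by move=> -[].
have E2 y : pos y -> (\int[mu]_x K (x, y) = \int[mu]_(x in pos) (k x y)%:E)%E.
  move=> px; rewrite [RHS]integral_mkcond; apply: eq_integral => x _.
  rewrite /K !patchE; congr (if _ then _ else _).
  by apply/idP/idP; rewrite !inE/= => // -[].
have E2' y : ~ pos y -> (\int[mu]_x K (x, y) = 0)%E.
  move=> px; apply: integral0_eq => x _; rewrite /K patchE memNset//.
  by move=> -[].
split.
  rewrite [LHS]integral_mkcond [RHS]integral_mkcond.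
  transitivity (\int[mu]_x \int[mu]_y K (x, y))%E.
    apply: eq_integral => x _; rewrite patchE; case: ifPn.
      by move=> /set_mem/E1.
    by move=> /negP px; rewrite E1'// => px'; apply: px; rewrite inE.
  transitivity (\int[mu]_y \int[mu]_x K (x, y))%E.
    exact: (@fubini_tonelli _ _ _ _ R mu mu K mK K0).
  apply: eq_integral => x _; rewrite patchE; case: ifPn.
    by move=> /set_mem/E2.
  by move=> /negP px; rewrite E2'// => px'; apply: px; rewrite inE.
apply: (eq_measurable_fun (fubini_F mu K)).
  by move=> x /set_mem/E1 <-.
by apply: measurable_funTS; exact: measurable_fun_fubini_tonelli_F.
Qed.

End PositiveHalfLine.

(** * The Gamma function and the Beta integral *)

Section GammaFunction.
Local Set Implicit Arguments.
Local Unset Strict Implicit.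
Context {R : realType}.
Notation mu := (@lebesgue_measure R).
Notation pos := (`]0%R, +oo[%classic : set R).
Implicit Types (s t : R).

Lemma powR_le_expR s t : 0 < s -> 0 < t -> t `^ s <= s `^ s * expR t.
Proof.
move=> s0 t0; have ts0 : 0 < t / s by rewrite divr_gt0.
have tE : t = s * (t / s) by rewrite mulrC divfK// gt_eqF.
have -> : expR t = expR (t / s) `^ s by rewrite -expRM divfK// gt_eqF.
rewrite {1}tE powRM ?(ltW s0) ?(ltW ts0)// ler_wpM2l ?powR_ge0//.
apply: ge0_ler_powR; rewrite ?nnegrE ?(ltW s0) ?(ltW ts0) ?expR_ge0//.
by apply: le_trans (expR_ge1Dx _); rewrite lerDr.
Qed.

Lemma continuous_gamma_integrand s t : 0 < t ->
  {for t, continuous (fun t => t `^ (s - 1) * expR (- t))}.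
Proof.
move=> t0.
exact: is_derive_continuous
  (is_deriveM (is_derive1_powR (s - 1) t0) (is_derive_expRNx t)).
Qed.

Lemma gamma_integrand_ge0 s t : 0 <= t `^ (s - 1) * expR (- t).
Proof. by rewrite mulr_ge0 ?powR_ge0 ?expR_ge0. Qed.

(** The integrand is dominated by a multiple of t^(s-1) / (1 + t^s)^2, which up
    to a constant is the opposite of the derivative of the bounded function
    1 / (1 + t^s). A single comparison thus handles both ends of the
    half-line. *)
Lemma integral_gamma_lty s : 0 < s ->
  (\int[mu]_(t in pos) (t `^ (s - 1) * expR (- t))%:E < +oo)%E.
Proof.
move=> s0.
(* [C] is such that [1 + t `^ s <= C * expR (t / 2)] *)
pose C := 1 + 2 `^ s * s `^ s.
have C0 : 0 < C by rewrite ltr_pwDl// mulr_ge0 ?powR_ge0.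
have bnd t : 0 < t -> (1 + t `^ s) ^+ 2 * expR (- t) <= C ^+ 2.
  move=> t0; have -> : expR (- t) = expR (- (t / 2)) ^+ 2.
    by rewrite -expRM_natl mulrN mulrC divfK.
  rewrite -exprMn lerXn2r ?nnegrE ?mulr_ge0 ?expR_ge0 ?(ltW C0) ?addr_ge0 ?powR_ge0//.
  rewrite expRN ler_pdivrMr ?expR_gt0// mulrDl mul1r lerD//.
    by rewrite -[leLHS]expR0 ler_expR divr_ge0// ltW.
  have -> : t `^ s = 2 `^ s * (t / 2) `^ s.
    by rewrite -powRM ?divr_ge0 ?(ltW t0)// mulrC divfK.
  by rewrite -mulrA ler_wpM2l ?powR_ge0// powR_le_expR// divr_gt0.
apply: (@le_lt_trans _ _ (C ^+ 2 / s)%:E); last exact: ltry.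
pose T t := C ^+ 2 / s * (1 + t `^ s)^-1.
pose f t := C ^+ 2 * t `^ (s - 1) / (1 + t `^ s) ^+ 2.
have D0 t : 0 < 1 + t `^ s by rewrite ltr_pwDl// powR_ge0.
have dD t : 0 < t -> is_derive t 1 (fun t => 1 + t `^ s) (s * t `^ (s - 1)).
  move=> t0; have H := is_deriveD (is_derive_cst (1 : R) t 1) (is_derive1_powR s t0).
  by apply: is_derive_eq H _; rewrite add0r.
have Tf t : 0 < t -> is_derive t 1 T (- f t).
  move=> t0; have Dn0 : 1 + t `^ s != 0 by rewrite gt_eqF.
  have H := is_deriveZ (C ^+ 2 / s)
    (@is_deriveV _ (fun t => 1 + t `^ s) _ _ _ Dn0 (dD t t0)).
  apply: is_derive_eq H _; rewrite /GRing.scale/= /f.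
  by field; rewrite Dn0 gt_eqF.
have cf t : 0 < t -> {for t, continuous f}.
  move=> t0; have Dn0 : 1 + t `^ s != 0 by rewrite gt_eqF.
  apply: cvgM.
    apply: cvgM; first exact: cvg_cst.
    exact: is_derive_continuous (is_derive1_powR (s - 1) t0).
  apply: cvgV; first by rewrite expf_neq0.
  have cD := is_derive_continuous (dD t t0).
  by apply: (@cvgM _ _ _ _ (fun t => 1 + t `^ s) (fun t => 1 + t `^ s)).
apply: (@le_trans _ _ (\int[mu]_(t in pos) (f t)%:E)%E).
  apply: ge0_le_integral => //.
  - by move=> t _; rewrite lee_fin gamma_integrand_ge0.
  - apply/measurable_EFinP; apply: continuous_pos_measurable => t.
    exact: continuous_gamma_integrand.
  - by apply/measurable_EFinP; exact: continuous_pos_measurable.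
  - move=> t /posE t0; rewrite lee_fin /f.
    rewrite ler_pdivlMr ?exprn_gt0// [leRHS]mulrC -mulrA ler_wpM2l ?powR_ge0//.
    by rewrite mulrC bnd.
apply: (@integral_pos_le_of_primitive _ T f) => //.
- move=> t t0; rewrite /f divr_ge0 ?exprn_ge0 ?(ltW (D0 _))//.
  by rewrite mulr_ge0 ?powR_ge0 ?exprn_ge0 ?(ltW C0).
- move=> t t0; rewrite /T mulr_ge0 ?invr_ge0 ?(ltW (D0 _))//.
  by rewrite divr_ge0 ?exprn_ge0 ?(ltW C0) ?(ltW s0).
- move=> t t0; rewrite /T ler_piMr ?divr_ge0 ?exprn_ge0 ?(ltW C0) ?(ltW s0)//.
  by rewrite invf_le1// lerDl powR_ge0.
Qed.

Lemma integral_gammaE s : 0 < s ->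
  (\int[mu]_(t in pos) (t `^ (s - 1) * expR (- t))%:E = (Gamma s)%:E)%E.
Proof.
move=> s0; rewrite /Gamma/Rintegral fineK// ge0_fin_numE ?integral_gamma_lty//.
by apply: integral_ge0 => t _; rewrite lee_fin gamma_integrand_ge0.
Qed.

(** It is enough to bound the integrand from below on [1, 2]. *)
Lemma Gamma_gt0 s : 0 < s -> 0 < Gamma s.
Proof.
move=> s0; rewrite -lte_fin -integral_gammaE//.
pose c : R := 2^-1 * expR (- 2).
have c0 : 0 < c by rewrite mulr_gt0 ?invr_gt0 ?expR_gt0.
have mg : measurable_fun pos (fun t => (t `^ (s - 1) * expR (- t))%:E).
  apply/measurable_EFinP; apply: continuous_pos_measurable => t.
  exact: continuous_gamma_integrand.
have sub : `[1%R, 2%R]%classic `<=` pos.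
  by move=> t/=; rewrite !in_itv/= andbT => /andP[/(lt_le_trans ltr01)].
apply: (@lt_le_trans _ _ (\int[mu]_(t in `[1%R, 2%R]) cst c%:E t)%E).
  rewrite integral_cst//= lebesgue_measure_itv/= lte_fin ltr1n/=.
  by rewrite -EFinB -EFinM lte_fin mulr_gt0// subr_gt0 ltr1n.
apply: (@le_trans _ _ (\int[mu]_(t in `[1%R, 2%R]) (t `^ (s - 1) * expR (- t))%:E)%E).
  apply: ge0_le_integral => //.
  - by move=> t _; rewrite lee_fin ltW.
  - exact: measurable_funS mg.
  - move=> t /=; rewrite in_itv/= => /andP[t1 t2]; rewrite lee_fin /c.
    have t0 : 0 < t by exact: lt_le_trans t1.
    apply: ler_pM; rewrite ?invr_ge0 ?expR_ge0//.
      apply: (@le_trans _ _ (t `^ (- 1))).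
        by rewrite powR_inv1 ?(ltW t0)// lef_pV2 ?posrE.
      by apply: ler_powR => //; lra.
    by rewrite ler_expR lerN2.
apply: ge0_subset_integral => //.
by move=> t _; rewrite lee_fin gamma_integrand_ge0.
Qed.

Lemma integral_pos_scale (x : R) (g : R -> R) : 0 < x ->
  (forall t, 0 < t -> {for t, continuous g}) -> (forall t, 0 < t -> 0 <= g t) ->
  (\int[mu]_(t in pos) (g t)%:E = \int[mu]_(t in pos) (g (x * t) * x)%:E)%E.
Proof.
move=> x0 cg g0.
apply: (@integral_pos_substitution _ (fun t => x * t) (fun=> x)) => //.
- move=> t t0; apply: is_derive_eq (is_deriveZ x (is_derive_id t 1)) _.
  by rewrite /GRing.scale/= mulr1.
- by move=> t _; exact: cvg_cst.
- by move=> t _; exact: ltW.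
- by move=> t u t0 tu; rewrite ltr_pM2l.
- by move=> t t0; rewrite mulr_gt0.
- move=> t t0; exists (t / x); first by rewrite divr_gt0.
  by rewrite mulrC divfK// gt_eqF.
Qed.

Lemma integral_pos_mull (c : R) (f : R -> R) : 0 <= c -> measurable_fun pos f ->
  (forall t, 0 < t -> 0 <= f t) ->
  (c%:E * \int[mu]_(t in pos) (f t)%:E = \int[mu]_(t in pos) (c * f t)%:E)%E.
Proof.
move=> c0 mf f0; under [RHS]eq_integral do rewrite EFinM.
rewrite ge0_integralZl//.
- exact/measurable_EFinP.
- by move=> t /posE t0; rewrite lee_fin f0.
Qed.

Lemma measurable_gamma_integrand s :
  measurable_fun pos (fun t => t `^ (s - 1) * expR (- t)).
Proof.
apply: continuous_pos_measurable => t; exact: continuous_gamma_integrand.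
Qed.

(** With u = e^(-s) the integral of this function over the half-line becomes the
    Beta integral of u^(y-1) (1 - u)^(l-1) over [0, 1]. *)
Definition beta_integrand (l y s : R) : R :=
  expR (- (y * s)) * (1 - expR (- s)) `^ (l - 1).

Lemma continuous_beta_integrand l y s : 0 < s -> {for s, continuous (beta_integrand l y)}.
Proof.
move=> s0; apply: cvgM.
  exact: is_derive_continuous (is_derive_expRN y s).
have dq : is_derive s 1 (fun t : R => 1 - expR (- t)) (0 - - expR (- s)).
  exact: is_deriveB (is_derive_cst (1 : R) s 1) (is_derive_expRNx s).
have H := @is_derive1_comp _ (fun y => y `^ (l - 1)) (fun t => 1 - expR (- t)) _ _ _
  (is_derive1_powR (l - 1) (subr_expRN_gt0 s0)) dq.
exact: is_derive_continuous H.
Qed.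

Lemma beta_integrand_ge0 l y s : 0 <= beta_integrand l y s.
Proof. by rewrite mulr_ge0 ?expR_ge0 ?powR_ge0. Qed.

(** The integrand u^(l-1) e^(-u) v^(y-1) e^(-v) of [Gamma l * Gamma y] after the
    change of variable u = v (e^s - 1), with its Jacobian v e^s; then
    v / (u + v) = e^(-s). Integrating in [s] undoes the change of variable, and
    integrating in [v] amounts to the scaling w = v e^s = u + v in the integral
    of [Gamma (l + y)]. *)
Definition beta_kernel (l y v s : R) : R :=
  v `^ (l + y - 1) * (expR s - 1) `^ (l - 1) * (expR s * expR (- (v * expR s))).

Lemma beta_kernel_ge0 l y v s : 0 <= beta_kernel l y v s.
Proof. by rewrite !mulr_ge0 ?powR_ge0 ?expR_ge0. Qed.

Lemma expR_subr_gt0 s : 0 < s -> 0 < expR s - 1.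
Proof. by move=> s0; rewrite subr_gt0 expR_gt1. Qed.

Lemma measurable_beta_kernel l y (D : set (R * R)) :
  measurable_fun D (fun z => beta_kernel l y z.1 z.2).
Proof.
apply: measurable_funTS.
have m1 : measurable_fun setT (fst : R * R -> R) by exact: measurable_fst.
have m2 : measurable_fun setT (snd : R * R -> R) by exact: measurable_snd.
have me : measurable_fun setT (fun z : R * R => expR z.2).
  exact: (measurableT_comp (@measurable_expR R) m2).
apply: measurable_funM.
  apply: measurable_funM.
    exact: (measurableT_comp (measurable_powR (l + y - 1)) m1).
  apply: (measurableT_comp (measurable_powR (l - 1))).
  by apply: measurable_funB.
apply: measurable_funM => //.
apply: (measurableT_comp (@measurable_expR R)).
apply: measurableT_comp => //.
exact: measurable_funM.
Qed.

Lemma integral_beta_kernel_snd l y v : 0 < l -> 0 < v ->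
  (\int[mu]_(s in pos) (beta_kernel l y v s)%:E =
   (Gamma l)%:E * (v `^ (y - 1) * expR (- v))%:E)%E.
Proof.
move=> l0 v0.
rewrite -(integral_gammaE l0) muleC integral_pos_mull; first last.
- by move=> t _; exact: gamma_integrand_ge0.
- exact: measurable_gamma_integrand.
- exact: gamma_integrand_ge0.
pose g (u : R) : R := v `^ (y - 1) * expR (- v) * (u `^ (l - 1) * expR (- u)).
transitivity (\int[mu]_(u in pos) (g u)%:E)%E => //.
have dF (s : R) : 0 < s ->
    is_derive s 1 (fun s => v * (expR s - 1)) (v * expR s).
  move=> _.
  have H := is_deriveZ v (is_deriveB (is_derive_expR s) (is_derive_cst (1 : R) s 1)).
  by apply: is_derive_eq H _; rewrite /GRing.scale/= subr0.
rewrite [RHS](integral_pos_substitution dF).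
- apply: eq_integral => s; rewrite inE => /posE s0; congr EFin.
  rewrite /beta_kernel /g.
  have -> : (v * (expR s - 1)) `^ (l - 1) = v `^ (l - 1) * (expR s - 1) `^ (l - 1).
    exact: (powRM (l - 1) (ltW v0) (ltW (expR_subr_gt0 s0))).
  have E1 : v `^ (l + y - 1) = v `^ (y - 1) * v `^ (l - 1) * v.
    have -> : l + y - 1 = (y - 1) + (l - 1) + 1 by ring.
    by rewrite !powRD_gt0// powRr1// ltW.
  rewrite E1.
  have -> : expR (- (v * expR s)) = expR (- v) * expR (- (v * (expR s - 1))).
    rewrite -expRD; congr expR; ring.
  ring.
- move=> s _; apply: cvgM; first exact: cvg_cst.
  exact: continuous_expR.
- by move=> s _; rewrite mulr_ge0 ?expR_ge0 ?ltW.
- by move=> s t s0 st; rewrite ltr_pM2l// ltrD2r ltr_expR.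
- by move=> s s0; rewrite mulr_gt0 ?expR_subr_gt0.
- move=> u u0; have uv : 0 < u / v by rewrite divr_gt0.
  exists (ln (1 + u / v)); first by rewrite ln_gt0 ?ltrDl.
  rewrite lnK ?posrE ?addr_gt0// addrAC subrr add0r mulrC divfK//.
  by rewrite gt_eqF.
- move=> u u0; apply: cvgM; first exact: cvg_cst.
  exact: continuous_gamma_integrand.
- by move=> u _; rewrite /g !mulr_ge0 ?powR_ge0 ?expR_ge0.
Qed.

Lemma integral_beta_kernel_fst l y s : 0 < l -> 0 < y -> 0 < s ->
  (\int[mu]_(v in pos) (beta_kernel l y v s)%:E =
   (Gamma (l + y))%:E * (beta_integrand l y s)%:E)%E.
Proof.
move=> l0 y0 s0; rewrite -integral_gammaE ?addr_gt0// muleC.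
rewrite [in RHS](@integral_pos_scale (expR s)) ?expR_gt0//; first last.
- by move=> t _; exact: gamma_integrand_ge0.
- by move=> t; exact: continuous_gamma_integrand.
rewrite integral_pos_mull; first last.
- by move=> t _; rewrite mulr_ge0 ?gamma_integrand_ge0 ?expR_ge0.
- apply: continuous_pos_measurable => t t0; apply: cvgM; last exact: cvg_cst.
  apply: (@continuous_comp _ _ _ (fun t => expR s * t)
    (fun u => u `^ (l + y - 1) * expR (- u))); first exact: mulrl_continuous.
  by apply: continuous_gamma_integrand; rewrite mulr_gt0 ?expR_gt0.
- exact: beta_integrand_ge0.
apply: eq_integral => v; rewrite inE => /posE v0; congr EFin.
rewrite /beta_kernel /beta_integrand powRM ?expR_ge0 ?(ltW v0)//.
rewrite -(expRM s (l + y - 1)).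
have -> : expR s - 1 = expR s * (1 - expR (- s)).
  by rewrite mulrBr mulr1 expRxMexpNx_1.
rewrite powRM ?expR_ge0 ?(ltW (subr_expRN_gt0 s0))// -expRM.
have -> : expR (s * (l - 1)) = expR (- (y * s)) * expR (s * (l + y - 1)).
  by rewrite -expRD; congr expR; ring.
rewrite [v * _]mulrC; ring.
Qed.

(** The two iterated integrals of [beta_kernel] agree. *)
Lemma Gamma_mul_beta l y : 0 < l -> 0 < y ->
  ((Gamma l * Gamma y)%:E =
   (Gamma (l + y))%:E * \int[mu]_(s in pos) (beta_integrand l y s)%:E)%E.
Proof.
move=> l0 y0.
transitivity (\int[mu]_(v in pos) \int[mu]_(s in pos) (beta_kernel l y v s)%:E)%E.
  rewrite EFinM -(integral_gammaE y0) integral_pos_mull; first last.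
  - by move=> t _; exact: gamma_integrand_ge0.
  - exact: measurable_gamma_integrand.
  - by rewrite ltW// Gamma_gt0.
  apply: eq_integral => v; rewrite inE => /posE v0.
  by rewrite integral_beta_kernel_snd// EFinM.
rewrite (@tonelli_pos _ (beta_kernel l y) (@measurable_beta_kernel l y _)
  (fun v s _ _ => beta_kernel_ge0 l y v s)).1 integral_pos_mull; first last.
- by move=> t _; exact: beta_integrand_ge0.
- by apply: continuous_pos_measurable => t; exact: continuous_beta_integrand.
- by rewrite ltW// Gamma_gt0// addr_gt0.
apply: eq_integral => s; rewrite inE => /posE s0.
by rewrite integral_beta_kernel_fst// EFinM.
Qed.

End GammaFunction.

(** * Integrals of the incomplete Gamma function *)

Section IncompleteGamma.
Local Set Implicit Arguments.
Local Unset Strict Implicit.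
Context {R : realType}.
Notation mu := (@lebesgue_measure R).
Notation pos := (`]0%R, +oo[%classic : set R).
Implicit Types (s t x y l : R).

Lemma measurable_natr_bool d (T : measurableType d) (D : set T) (P : T -> bool) :
  measurable_fun D P -> measurable_fun D (fun z => (P z)%:R : R).
Proof.
move=> mP; apply: (measurableT_comp (f := fun c : bool => c%:R : R)) mP.
by move=> _ Y _.
Qed.

Lemma integral_pos_indic (A : set R) (P : pred R) (f : R -> R) :
  (forall t, A t <-> 0 < t /\ P t) ->
  (\int[mu]_(t in pos) ((P t)%:R * f t)%:E = \int[mu]_(t in A) (f t)%:E)%E.
Proof.
move=> AP; rewrite [LHS]integral_mkcond [RHS]integral_mkcond.
apply: eq_integral => t _; rewrite !patchE.
case: ifPn => [/set_mem/posE t0|tn0].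
  case: ifPn => [/set_mem/AP[_ ->]|tA]; first by rewrite mul1r.
  case: (boolP (P t)) => Pt; last by rewrite mul0r.
  by move: tA; rewrite notin_setE => -[]; apply/AP.
rewrite memNset// => /AP[t0 _]; move: tn0; rewrite notin_setE; apply.
exact/posE.
Qed.

Lemma integral_incomplete_gammaE l y : 0 < l ->
  (\int[mu]_(s in pos) ((s < y)%R%:R * (s `^ (l - 1) * expR (- s)))%:E =
   (incomplete_gamma l y)%:E)%E.
Proof.
move=> l0; rewrite (@integral_pos_indic `]0, y[%classic (fun s => s < y)); last first.
  by move=> t; rewrite /= in_itv/=; split=> [/andP//|[-> ->]].
rewrite /incomplete_gamma/Rintegral fineK// ge0_fin_numE; last first.
  by apply: integral_ge0 => t _; rewrite lee_fin gamma_integrand_ge0.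
apply: le_lt_trans (integral_gamma_lty l0); apply: ge0_subset_integral => //.
- by apply/measurable_EFinP; exact: measurable_gamma_integrand.
- by move=> t _; rewrite lee_fin gamma_integrand_ge0.
- by move=> t/=; rewrite !in_itv/= andbT => /andP[].
Qed.

(** Tonelli's theorem on the domain s < x t: integrating first in [s] gives the
    incomplete Gamma function, and integrating first in [t > s / x] gives the
    primitive [T (s / x)] of [phi] that vanishes at infinity. *)
Lemma integral_incomplete_gamma_density l x (T phi : R -> R) :
  0 < l -> 0 < x ->
  (forall t, 0 < t -> is_derive t 1 T (- phi t)) ->
  (forall t, 0 < t -> {for t, continuous phi}) ->
  (forall t, 0 < t -> 0 <= phi t) -> T t @[t --> +oo] --> 0 ->
  measurable_fun pos (fun t => (incomplete_gamma l (x * t) * phi t)%:E) /\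
  (\int[mu]_(t in pos) (incomplete_gamma l (x * t) * phi t)%:E =
   \int[mu]_(s in pos) (s `^ (l - 1) * expR (- s) * T (s / x))%:E)%E.
Proof.
move=> l0 x0 dT cphi phi0 T0.
pose k t s := (s < x * t)%R%:R * (s `^ (l - 1) * expR (- s)) * phi t.
have k0 t s : 0 < t -> 0 < s -> 0 <= k t s.
  by move=> t0 _; rewrite mulr_ge0 ?phi0// mulr_ge0// gamma_integrand_ge0.
have mpp : measurable (pos `*` pos) by exact: measurableX.
have mk : measurable_fun (pos `*` pos) (fun z => k z.1 z.2).
  have m1 : measurable_fun (pos `*` pos) (fst : R * R -> R).
    by apply: measurable_funTS; exact: measurable_fst.
  have m2 : measurable_fun (pos `*` pos) (snd : R * R -> R).
    by apply: measurable_funTS; exact: measurable_snd.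
  have mcomp1 (f : R -> R) : measurable_fun pos f ->
      measurable_fun (pos `*` pos) (fun z => f z.1).
    move=> mf; apply: (measurable_comp _ _ mf m1) => //.
    by move=> _ [z [z1 _] <-].
  have mcomp2 (f : R -> R) : measurable_fun pos f ->
      measurable_fun (pos `*` pos) (fun z => f z.2).
    move=> mf; apply: (measurable_comp _ _ mf m2) => //.
    by move=> _ [z [_ z2] <-].
  apply: measurable_funM; last first.
    by apply: mcomp1; exact: continuous_pos_measurable.
  apply: measurable_funM; last first.
    by apply: (mcomp2 (fun s => s `^ (l - 1) * expR (- s))); exact: measurable_gamma_integrand.
  apply: measurable_natr_bool.
  apply: measurable_fun_ltr => //.
  by apply: (mcomp1 (fun t => x * t)); exact: mulrl_measurable.
have [swap mF] := tonelli_pos mk k0.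
have inner t : 0 < t -> (\int[mu]_(s in pos) (k t s)%:E =
    (incomplete_gamma l (x * t) * phi t)%:E)%E.
  move=> t0; rewrite mulrC EFinM -integral_incomplete_gammaE// integral_pos_mull.
  - by apply: eq_integral => s _; rewrite mulrC.
  - exact: phi0.
  - apply: measurable_funM; last exact: measurable_gamma_integrand.
    apply: measurable_natr_bool.
    exact: measurable_fun_ltr.
  - by move=> s s0; rewrite mulr_ge0// gamma_integrand_ge0.
split.
  by apply: eq_measurable_fun mF => t; rewrite inE => /posE/inner.
transitivity (\int[mu]_(t in pos) \int[mu]_(s in pos) (k t s)%:E)%E.
  by apply: eq_integral => t; rewrite inE => /posE/inner.
rewrite swap; apply: eq_integral => s; rewrite inE => /posE s0.
have sx0 : 0 < s / x by rewrite divr_gt0.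
rewrite EFinM -(integral_tail sx0 dT cphi phi0 T0).
rewrite -(@integral_pos_indic `](s / x), +oo[%classic (fun t => s < x * t)); last first.
  move=> t; rewrite /= in_itv/= andbT ltr_pdivrMr// mulrC; split=> [st|[]//].
  by split => //; rewrite -(pmulr_rgt0 _ x0); exact: lt_trans st.
rewrite integral_pos_mull.
- by apply: eq_integral => t _; congr EFin; rewrite /k; ring.
- exact: gamma_integrand_ge0.
- apply: measurable_funM; last exact: continuous_pos_measurable.
  apply: measurable_natr_bool.
  by apply: measurable_fun_ltr => //; exact: mulrl_measurable.
- by move=> t t0; rewrite mulr_ge0// phi0.
Qed.

Lemma integral_beta_integrandE l y : 0 < l -> 0 < y ->
  (\int[mu]_(s in pos) (beta_integrand l y s)%:E =
   (Gamma l * Gamma y / Gamma (l + y))%:E)%E.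
Proof.
move=> l0 y0; have G0 := Gamma_gt0 (addr_gt0 l0 y0).
rewrite mulrC EFinM Gamma_mul_beta// muleA -EFinM mulVf ?mul1e//.
by rewrite gt_eqF.
Qed.

(** After s = x t the power t^(l-1) cancels the denominator of the power of
    [moment 0] in [tail], leaving the integrand of the Beta integral at
    [y = x + b]. *)
Lemma integral_gamma_tail l b x : 0 < l -> 0 < b -> 0 < x ->
  (\int[mu]_(s in pos)
     (s `^ (l - 1) * expR (- s) * ((Gamma l)^-1 * tail b (l - 1) (s / x)))%:E =
   (x `^ l * (Gamma (x + b) / Gamma (l + (x + b))))%:E)%E.
Proof.
move=> l0 b0 x0; have G0 := Gamma_gt0 l0.
have tail_cont t : 0 < t -> {for t, continuous (tail b (l - 1))}.
  by move=> t0; exact: is_derive_continuous (is_derive_tail b (l - 1) t0).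
rewrite (@integral_pos_scale _ x)//; first last.
- move=> t t0; rewrite mulr_ge0 ?gamma_integrand_ge0// mulr_ge0 ?tail_ge0//.
  by rewrite invr_ge0 ltW.
- move=> t t0; apply: cvgM; first exact: continuous_gamma_integrand.
  apply: cvgM; first exact: cvg_cst.
  apply: (@continuous_comp _ _ _ (fun t => t / x) (tail b (l - 1))).
    exact: mulrr_continuous.
  by apply: tail_cont; rewrite divr_gt0.
transitivity (\int[mu]_(t in pos) (x `^ l / Gamma l * beta_integrand l (x + b) t)%:E)%E.
  apply: eq_integral => t; rewrite inE => /posE t0; congr EFin.
  rewrite /tail /beta_integrand powR_moment0 ?divr_gt0 ?mulr_gt0//.
  have -> : x * t / x = t by rewrite mulrC mulKf// gt_eqF.
  rewrite (powRM (l - 1) (ltW x0) (ltW t0)) powRN.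
  have -> : x `^ l = x `^ (l - 1) * x by rewrite mulrC mulr_powRB1// ltW.
  have -> : expR (- ((x + b) * t)) = expR (- (x * t)) * expR (- (b * t)).
    by rewrite -expRD; congr expR; ring.
  by field; rewrite !gt_eqF// powR_gt0.
rewrite -integral_pos_mull; first last.
- by move=> t _; exact: beta_integrand_ge0.
- by apply: continuous_pos_measurable => t; exact: continuous_beta_integrand.
- by rewrite divr_ge0 ?powR_ge0// ltW.
rewrite integral_beta_integrandE ?addr_gt0// -EFinM; congr EFin.
by rewrite -!mulrA mulKf// gt_eqF.
Qed.

End IncompleteGamma.

(** * The ratio of Gamma functions *)

Theorem theorem3p6 (R : realType) (a b : R) :
  0 < b -> b < a -> 1 < a ->
  thorin_bernstein (a - b) (- 3) (gamma_ratio a b).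
Proof.
move=> b0 ba a1; set l := a - b.
have l0 : 0 < l by rewrite subr_gt0.
have m1 : -1 < l - 1 by lra.
have bm : 0 < b + (l - 1) by rewrite /l; lra.
have G0 := Gamma_gt0 l0.
have D0 (t : R) : 0 < t -> 0 <= density b (l - 1) t.
  move=> t0; have := alternating_ge0 (alternating_density 0 b0 m1 bm) t0.
  by rewrite pmulr_rge0// powR_gt0.
split => //; first by lra.
pose phi (t : R) := (Gamma l)^-1 * density b (l - 1) t.
pose T (t : R) := (Gamma l)^-1 * tail b (l - 1) t.
have phi0 (t : R) : 0 < t -> 0 <= phi t.
  by move=> t0; rewrite mulr_ge0 ?D0// invr_ge0 ltW.
have dT (t : R) : 0 < t -> is_derive t 1 T (- phi t).
  move=> t0.
  apply: is_derive_eq (is_deriveZ (Gamma l)^-1 (is_derive_tail b (l - 1) t0)) _.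
  by rewrite /GRing.scale/= mulrN.
have cphi (t : R) : 0 < t -> {for t, continuous phi}.
  by move=> t0; apply: cvgM; [exact: cvg_cst|exact: continuous_density].
have T0 : T t @[t --> +oo] --> 0.
  by rewrite -(mulr0 (Gamma l)^-1); apply: cvgMr; exact: tail_cvg0.
have ig (x : R) : 0 < x -> (\int[lebesgue_measure]_(t in `]0%R, +oo[)
    (incomplete_gamma l (x * t) * phi t)%:E = (gamma_ratio a b x)%:E)%E.
  move=> x0; rewrite (integral_incomplete_gamma_density l0 x0 dT cphi phi0 T0).2.
  have xaE : l + (x + b) = x + a by rewrite /l; ring.
  by rewrite (integral_gamma_tail l0 b0 x0) xaE.
have inc0 (x : R) : 0 <= incomplete_gamma l x.
  by apply: Rintegral_ge0 => u _; exact: gamma_integrand_ge0.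
exists 0, 0, phi; split => //.
- apply: alternating_completely_monotonic => n.
  apply: (@alternating_congr _ _
      (fun t => (Gamma l)^-1 * (t `^ (- 3) * density b (l - 1) t))).
    by move=> t _; rewrite /phi mulrCA.
  apply: alternatingZ; first by rewrite invr_ge0 ltW.
  exact: alternating_density.
- move=> x x0; apply/integrableP; split.
    exact: (integral_incomplete_gamma_density l0 x0 dT cphi phi0 T0).1.
  under eq_integral => t.
    rewrite inE => /posE t0; rewrite gee0_abs; last first.
      by rewrite lee_fin mulr_ge0 ?phi0.
    over.
  by rewrite ig// ltry.
- by move=> x x0; rewrite mul0r !add0r /Rintegral ig.
Qed.
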